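(* If $G$ is a complete bipartite graph $K_{n,m}$ or a caterpillar, then the graph associahedron $\mathcal{A}(G)$ has a facet-Hamiltonian path.
   Context: Let $G=(V,E)$ be a connected simple graph. A tube of $G$ is a nonempty proper subset $t\subsetneq V$ such that $G[t]$ is connected. Two distinct tubes $t_1,t_2$ are compatible if they are nested ($t_1\subset t_2$ or $t_2\subset t_1$) or non-adjacent ($G[t_1\cup t_2]$ is disconnected). A tubing is a set of pairwise compatible tubes. The graph associahedron $\mathcal{A}(G)$ is the polytope whose face lattice is isomorphic to the set of tubings ordered by reverse inclusion; vertices correspond to maximal tubings, facets to tubes (a vertex lies on the facet of $t$ iff $t$ is in the tubing), and two vertices are adjacent iff the maximal tubings differ in exactly one tube. A path $P$ in the skeleton (vertex-edge graph) of a polytope is facet-Hamiltonian if for every facet $f$, $f\cap P$ is nonempty and connected. A caterpillar is a tree that becomes a path when all its leaves are removed. *)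

(* Defs.v *)
From HB Require Import structures.
From mathcomp Require Import all_boot all_order.

Set Implicit Arguments.
Unset Strict Implicit.
Unset Printing Implicit Defensive.

Import Order.TTheory.

Section Graphs.
Variables (T : finType) (e : rel T).

Definition simple_graph := symmetric e /\ irreflexive e.

(* The subgraph induced on A is connected; the empty graph is not. *)
Definition connected_on (A : {set T}) : bool :=
  (A != set0) &&
  [forall x in A, forall y in A,
     connect [rel u v | [&& u \in A, v \in A & e u v]] x y].

Definition connected_graph := connected_on [set: T].

Definition complete_bipartite (n m : nat) :=
  exists A : {set T}, [/\ #|A| = n, #|~: A| = m
    & forall x y, e x y = (x \in A) (+) (y \in A)].

Definition tree :=
  connected_graph /\ forall c : seq T, 2 < size c -> ~ ucycle e c.

Definition leaf (x : T) := #|[set y | e x y]| == 1.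

Definition consecutive (s : seq T) : rel T :=
  [rel x y | infix [:: x; y] s || infix [:: y; x] s].

(* The subgraph induced on A is a path; A may be empty, so that the one-edge
   graph is a caterpillar. *)
Definition is_path_on (A : {set T}) :=
  exists s : seq T, [/\ uniq s, s =i A
    & {in A &, forall x y, e x y = consecutive s x y}].

Definition caterpillar := tree /\ is_path_on [set x | ~~ leaf x].

Definition tube (t : {set T}) := (t \proper [set: T]) && connected_on t.

Definition compatible (t1 t2 : {set T}) :=
  [|| t1 \proper t2, t2 \proper t1 | ~~ connected_on (t1 :|: t2)].

Definition tubing (X : {set {set T}}) :=
  [forall t in X, tube t] &&
  [forall t1 in X, forall t2 in X, (t1 != t2) ==> compatible t1 t2].

End Graphs.

(* A polytope enters through the poset of its nonempty faces, whose top is the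
   polytope itself.  Vertices are the minimal faces, facets the maximal proper
   faces, and edges the faces covering a vertex. *)
Section Polytopes.
Context {d : Order.disp_t} {F : finTPOrderType d}.
Local Open Scope order_scope.

Definition covered_by (x y : F) := (x < y) && ~~ [exists z, x < z < y].

Definition vertex (v : F) := [forall x, (x <= v) ==> (x == v)].

Definition facet (f : F) := covered_by f \top.

Definition skeleton : rel F :=
  [rel v w | [&& vertex v, vertex w, v != w
    & [exists x, covered_by v x && covered_by w x]]].

(* s lists the vertices of the path P in order.  A facet contains an edge of P
   exactly when it contains both its endpoints, so the intersection of P with
   f is the subgraph of P induced on the vertices of P lying on f. *)
Definition facet_hamiltonian_path (s : seq F) :=
  [/\ s != [::], uniq s, all vertex s, sorted skeleton s
    & forall f, facet f -> connected_on (consecutive s) [set v in s | v <= f]].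

End Polytopes.

Section GraphAssociahedron.
Variables (T : finType) (e : rel T).

Record graph_associahedron :=
  Face { tubing_of_face : {set {set T}}; _ : tubing e tubing_of_face }.

HB.instance Definition _ := [isSub for tubing_of_face].
HB.instance Definition _ := [Finite of graph_associahedron by <:].

Fact graph_associahedron_display : Order.disp_t. Proof. by []. Qed.

Definition face_le (X Y : graph_associahedron) := val Y \subset val X.

Fact face_le_refl : reflexive face_le.
Proof. by move=> X; apply: subxx. Qed.

Fact face_le_anti : antisymmetric face_le.
Proof. by move=> X Y ?; apply/val_inj/eqP; rewrite eqEsubset andbC. Qed.

Fact face_le_trans : transitive face_le.
Proof. by move=> Y X Z XY YZ; apply: subset_trans YZ XY. Qed.

HB.instance Definition _ :=
  Order.Le_isPOrder.Build graph_associahedron_display graph_associahedron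
    face_le_refl face_le_anti face_le_trans.

Fact tubing0 : tubing e set0.
Proof. by apply/andP; split; apply/forall_inP=> t; rewrite inE. Qed.

Fact face_le_top (X : graph_associahedron) :
  face_le X (Face tubing0).
Proof. exact: sub0set. Qed.

HB.instance Definition _ :=
  Order.hasTop.Build graph_associahedron_display graph_associahedron
    face_le_top.

Lemma sub_tubing (X Y : {set {set T}}) :
  X \subset Y -> tubing e Y -> tubing e X.
Proof.
move=> /subsetP XY /andP[/forall_inP tY /forall_inP cY]; apply/andP; split.
  by apply/forall_inP=> t /XY /tY.
by apply/forall_inP=> t /XY /cY /forall_inP ct; apply/forall_inP=> u /XY /ct.
Qed.

Lemma tubing1 t : tubing e [set t] = tube e t.
Proof.
apply/andP/idP=> [[/forall_inP tt _] | tt]; first by rewrite tt ?set11.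
split; apply/forall_inP=> u /set1P-> //.
by apply/forall_inP=> v /set1P->; rewrite eqxx.
Qed.

Lemma face_leE (X Y : graph_associahedron) :
  (X <= Y)%O = (val Y \subset val X).
Proof. by []. Qed.

Lemma face_ltE (X Y : graph_associahedron) :
  (X < Y)%O = (val Y \proper val X).
Proof. by rewrite lt_neqAle face_leE properEneq -val_eqE eq_sym. Qed.

Lemma covered_byP (X Y : graph_associahedron) :
  reflect (exists2 t, t \notin val Y & val X = t |: val Y) (covered_by X Y).
Proof.
apply: (iffP andP) => [[XY nZ] | [t tY eX]].
  move: XY; rewrite face_ltE => /properP[YX [t tX tY]]; exists t => //.
  have tbZ : tubing e (t |: val Y).
    by apply: sub_tubing (valP X); rewrite subUset sub1set tX.
  pose Z := Face tbZ.
  apply/eqP; rewrite eqEsubset [X in _ && X]subUset sub1set tX YX !andbT.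
  apply: contraNT nZ => XZ; apply/existsP; exists Z.
  rewrite !face_ltE /= !properE XZ subsetUr !subUset !sub1set tX YX /=.
  by rewrite (negPf tY).
rewrite face_ltE eX; split.
  by rewrite properE subsetUr subUset sub1set negb_and tY.
apply/existsP=> -[Z]; rewrite !face_ltE eX => /andP[/proper_card + /proper_card].
by rewrite cardsU1 tY ltnS => /leq_ltn_trans /[apply]; rewrite ltnn.
Qed.

Lemma vertexE (X : graph_associahedron) :
  vertex X = maxset (tubing e) (val X).
Proof.
apply/forall_inP/maxsetP => [vX | [_ mX] Y /(mX _ (valP Y)) ?].
  split=> [|Y tY XY]; first exact: valP.
  by have /eqP<- := vX (Face tY) XY.
exact/eqP/val_inj.
Qed.

Lemma facetP (X : graph_associahedron) :
  reflect (exists2 t, tube e t & val X = [set t]) (facet X).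
Proof.
apply: (iffP (covered_byP _ _)) => -[t] /=; rewrite ?setU0 => h eX; exists t.
- by rewrite -tubing1 -eX; apply: valP.
- exact: eX.
- by rewrite inE.
- by rewrite setU0.
Qed.

Lemma vertex_facetE (v f : graph_associahedron) t :
  val f = [set t] -> (v <= f)%O = (t \in val v).
Proof. by rewrite face_leE => ->; rewrite sub1set. Qed.

Lemma skeletonE (v w : graph_associahedron) :
  skeleton v w = [&& vertex v, vertex w, #|val v :\: val w| == 1
                   & #|val w :\: val v| == 1].
Proof.
rewrite /skeleton /=; case: (vertex v) => //=; case: (vertex w) => //=.
apply/andP/andP=> [[vw /existsP[x /andP[]]] | []].
  move=> /covered_byP[t tx ev] /covered_byP[u ux ew].
  have tu : t != u by apply: contraNneq vw => tu; rewrite -val_eqE ev ew tu.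
  rewrite ev ew; split; apply/cards1P; [exists t | exists u]; apply/setP=> z.
    rewrite !inE negb_or; have [->|_] := eqVneq z t; first by rewrite tu tx.
    by case: (z \in val x); rewrite ?andbF.
  rewrite !inE negb_or; have [->|_] := eqVneq z u.
    by rewrite eq_sym tu ux.
  by case: (z \in val x); rewrite ?andbF.
move=> /cards1P[t et] /cards1P[u eu].
have tbx : tubing e (val v :&: val w) := sub_tubing (subsetIl _ _) (valP v).
have /setDP[tv tw] : t \in val v :\: val w by rewrite et set11.
have /setDP[uw uv] : u \in val w :\: val v by rewrite eu set11.
split; first by apply: contraNneq tw => <-.
apply/existsP; exists (Face tbx); apply/andP; split; apply/covered_byP.
  by exists t; rewrite /= ?inE ?(negPf tw) ?andbF// -et setUC setID.
by exists u; rewrite /= ?inE ?(negPf uv) ?andbF// -eu setIC setUC setID.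
Qed.

End GraphAssociahedron.

(* Main.v *)
Require Import Defs.
From mathcomp Require Import all_boot all_order.

(** List the vertices in a word w and keep the tubes all of whose vertices
  precede all their outer neighbours.  This is a maximal tubing, and exchanging
  two consecutive letters of w either preserves it or flips a single tube.  A
  facet-Hamiltonian path thus amounts to a list of words, each obtained from
  the previous one by such an exchange, along which every tube is present
  during exactly one time interval.

  Such lists are built by adding vertices one at a time.  To add v, start with
  v in front and let the rest of the word run through a list (a "strip") in
  which every set X with v + X connected is an initial segment during one
  interval: this covers the tubes containing v.  Then v climbs to the end of
  the word, losing only tubes that contain v and gaining only tubes that do
  not, and the list for the graph without v takes over.

  A strip for n + 1 letters comes from two strips for n letters, with the new
  letter first in front and then at the back.  For K_{n,m} this gives strips of
  all sets meeting the side of size n, running between words of the form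
  a b..b a..a.  A caterpillar is built by adding pendant vertices to a current
  root r, with r or the new vertex as the next root; there the strips consist
  of the connected sets containing the root. *)

Set Implicit Arguments.
Unset Strict Implicit.
Unset Printing Implicit Defensive.

(** * Boolean sequences whose true entries form one interval *)

Lemma sorted_join (A : Type) (r : rel A) (x0 : A) (s1 s2 : seq A) :
  sorted r s1 -> sorted r s2 -> r (last x0 s1) (head x0 s2) ->
  sorted r (s1 ++ s2).
Proof.
case: s1 => [//|x s1] /= p1; case: s2 => [|y s2] /= p2; first by rewrite cats0.
by move=> r12; rewrite cat_path p1 /= r12.
Qed.

Lemma last_map_neq0 (A B : eqType) (f : A -> B) y x (s : seq A) :
  s != [::] -> last y (map f s) = f (last x s).
Proof. by case: s => //= z s _; rewrite last_map. Qed.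

(** [sorted implb] describes falses followed by trues. The explicit [true] in the middle makes the
    interval nonempty, as a facet-Hamiltonian path requires of every facet. *)
Definition unimodal (s : seq bool) : Prop :=
  exists s1 s2, [/\ s = s1 ++ true :: s2, sorted implb s1
    & sorted (fun a b => b ==> a) s2].

Lemma unimodal_rev s : unimodal s -> unimodal (rev s).
Proof.
move=> [s1 [s2 [-> r1 r2]]]; exists (rev s2), (rev s1); split.
- by rewrite rev_cat rev_cons cat_rcons.
- by rewrite rev_sorted.
- by rewrite rev_sorted.
Qed.

Lemma unimodal_cat_fall s s' :
  unimodal s -> sorted (fun a b => b ==> a) s' ->
  head false s' ==> last false s -> unimodal (s ++ s').
Proof.
move=> [s1 [s2 [-> r1 r2]]] r' j; exists s1, (s2 ++ s').
split=> //; first by rewrite -catA.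
case: s' r' j => [|b s'] r' j; first by rewrite cats0.
by apply: (@sorted_join _ _ true); rewrite // last_cat in j *.
Qed.

Lemma unimodal_cat_rise s s' :
  unimodal s -> sorted implb s' ->
  last false s' ==> head false s -> unimodal (s' ++ s).
Proof.
move=> us rs' j; rewrite -[_ ++ _]revK; apply: unimodal_rev.
rewrite rev_cat; apply: unimodal_cat_fall; first exact: unimodal_rev.
  by rewrite rev_sorted.
case: s j us => [|b s] j us; first by case: us => [[|? ?] [? []]].
rewrite rev_cons last_rcons; case/lastP: s' j rs' => [//|s' c].
by rewrite last_rcons rev_rcons.
Qed.

Lemma unimodal_true (A : eqType) (p : pred A) (s : seq A) :
  s != [::] -> {in s, forall w, p w} -> unimodal [seq p w | w <- s].
Proof.
case: s => [//|x s] _ ps; exists [::], [seq p w | w <- s].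
rewrite /= ps ?mem_head //; split=> //.
elim: s x ps => [//|y s IH] x ps /=.
have {}IH := IH y (fun w ws => ps w (mem_behead (s := x :: y :: s) ws)).
case: s IH ps => [//|z s] IH ps /=; rewrite [p y]ps ?implybT ?inE ?eqxx ?orbT //.
Qed.

Lemma sorted_rise_false (A : eqType) (p : pred A) (s : seq A) :
  {in s, forall w, ~~ p w} -> sorted implb [seq p w | w <- s].
Proof.
move=> ps; rewrite sorted_map; case: s ps => [//|x s] /=.
elim: s x => [//|y s IH] x ps /=.
rewrite (negPf (ps x (mem_head _ _))) /=; apply: IH => w ws.
by apply: ps; rewrite inE ws orbT.
Qed.

Lemma sorted_fall_false (A : eqType) (p : pred A) (s : seq A) :
  {in s, forall w, ~~ p w} -> sorted (fun a b => b ==> a) [seq p w | w <- s].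
Proof.
move=> ps; rewrite -(revK [seq _ | _ <- _]) rev_sorted -map_rev.
by apply: sorted_rise_false => w; rewrite mem_rev => /ps.
Qed.

(** The three entries split into a part from the rising half and a part from the falling half.
    Either the rising part holds the first [true] and [b], or the falling part holds [b] and the
    last [true]. *)
Lemma unimodal_convex (s : seq bool) b :
  unimodal s -> subseq [:: true; b; true] s -> b.
Proof.
move=> [s1 [s2 [-> r1 r2]]] /subseqP[m].
rewrite size_cat => sm; rewrite -(cat_take_drop (size s1) m).
rewrite mask_cat; last by rewrite size_takel // sm leq_addr.
set u1 := mask _ s1; set u2 := mask _ (true :: s2) => e3.
have su1 : sorted implb u1.
  apply: subseq_sorted r1; last by apply/subseqP; exists (take (size s1) m);
    rewrite // size_takel // sm leq_addr.
  by move=> [] [] [].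
have su2 : sorted (fun a b => b ==> a) u2.
  have r2' : sorted (fun a b => b ==> a) (true :: s2).
    by case: (s2) r2 => [//|c s'] /= ->; rewrite implybT.
  apply: subseq_sorted r2'; first by move=> [] [] [].
  exact: mask_subseq.
case: u1 e3 su1 => [|c1 [|c2 u1]] /=.
- by move=> e3 _; move: su2; rewrite -e3 /=; case: b {e3}.
- by case=> _ e3 _; move: su2; rewrite -e3 /=; case: b {e3}.
- by case=> <- <- _ /andP[].
Qed.

(** * Words, exchanges of consecutive letters, and insertion of a letter *)

Section Words.
Variable T : finType.
Implicit Types (w a b S E W : seq T) (U X Y : {set T}) (s : seq (seq T)).

(** A letter absent from [w] has index [size w], hence counts as coming after every letter of [w].
    Words on part of the vertices therefore ignore the remaining vertices of [Y]. *)
Definition before w X Y :=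
  [forall x in X, forall y in Y, index x w < index y w].

Lemma beforeP w X Y :
  reflect {in X & Y, forall x y, index x w < index y w} (before w X Y).
Proof.
apply: (iffP forall_inP) => [h x y xX yY | h x xX].
  exact: (forall_inP (h x xX)).
by apply/forall_inP => y yY; apply: h.
Qed.

Lemma before_swap a x y b X Y :
  ~~ ((x \in X) && (y \in Y)) ->
  before (a ++ x :: y :: b) X Y -> before (a ++ y :: x :: b) X Y.
Proof.
move=> nxy /beforeP h; apply/beforeP => u v uX vY; move: (h u v uX vY).
rewrite !index_cat; case: ifP => ua; case: ifP => va //=.
- by move=> _; apply: ltn_addr; rewrite index_mem.
- move=> /(leq_ltn_trans (leq_addr _ _)) /ltn_trans.
  by move=> /(_ _ (etrans (index_mem _ _) va)); rewrite ltnn.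
- by rewrite !ltn_add2l; case: (x =P u) => [xu|_]; case: (x =P v) => [xv|_];
    case: (y =P u) => [yu|_]; case: (y =P v) => [yv|_] //=;
    rewrite ?ltnS //; move: nxy; rewrite ?xu ?yv ?uX ?vY.
Qed.

(** An absent letter already counts as last, so writing it at the end changes nothing for sets of
    letters of [w]. *)
Lemma before_rcons w v X Y :
  {subset X <= w} -> before (rcons w v) X Y = before w X Y.
Proof.
move=> Xw; apply: eq_forallb_in => x xX; apply: eq_forallb_in => y _.
rewrite -cats1 !index_cat Xw //; case: ifP => // /negbT yw.
by rewrite (memNindex yw) ltn_addr ?index_mem ?Xw.
Qed.

Lemma before_rconsN w v y X Y :
  v \in X -> y \in Y -> y \in w -> v \notin w -> ~~ before (rcons w v) X Y.
Proof.
move=> vX yY yw vw; apply/beforeP => /(_ v y vX yY).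
rewrite -cats1 !index_cat yw (negPf vw) /= eqxx addn0 => /ltn_trans.
by move=> /(_ _ (etrans (index_mem _ _) yw)); rewrite ltnn.
Qed.

(** When fewer than two letters remain from position [i] on, the word is unchanged. This makes [adj]
    reflexive, so that words may be repeated where two lists meet. *)
Definition swap i w :=
  if drop i w is x :: y :: b then take i w ++ y :: x :: b else w.

Definition adj w w' := has (fun i => w' == swap i w) (iota 0 (size w).+1).

Lemma adjP w w' :
  reflect (w' = w \/ exists a x y b,
             w = a ++ x :: y :: b /\ w' = a ++ y :: x :: b) (adj w w').
Proof.
apply: (iffP hasP) => [[i _ /eqP->] | [-> | [a [x [y [b [-> ->]]]]]]].
- rewrite /swap; case e: (drop i w) => [|x [|y b]]; [by left | by left|].
  by right; exists (take i w), x, y, b; rewrite -e cat_take_drop.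
- by exists (size w); rewrite ?mem_iota ?add0n ?leqnn // /swap drop_size.
- exists (size a); first by rewrite mem_iota add0n ltnS size_cat leq_addr.
  by rewrite /swap drop_size_cat // take_size_cat.
Qed.

Lemma adj_refl : reflexive adj.
Proof. by move=> w; apply/adjP; left. Qed.

Lemma adj_sym : symmetric adj.
Proof.
by move=> w w'; apply/adjP/adjP => -[-> | [a [x [y [b [-> ->]]]]]];
  first [by left | by right; exists a, y, x, b].
Qed.

Lemma adj_swap a x y b : adj (a ++ x :: y :: b) (a ++ y :: x :: b).
Proof. by apply/adjP; right; exists a, x, y, b. Qed.

Lemma adj_cons v w w' : adj w w' -> adj (v :: w) (v :: w').
Proof.
move=> /adjP[-> | [a [x [y [b [-> ->]]]]]]; first exact: adj_refl.
exact: (adj_swap (v :: a)).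
Qed.

Lemma adj_rcons v w w' : adj w w' -> adj (rcons w v) (rcons w' v).
Proof.
move=> /adjP[-> | [a [x [y [b [-> ->]]]]]]; first exact: adj_refl.
by rewrite !rcons_cat; apply: adj_swap.
Qed.

(* The words in which v occupies successively every position of W. *)
Fixpoint climb v W :=
  (v :: W) :: (if W is y :: W' then map (cons y) (climb v W') else [::]).

(** The relation is arbitrary because the lemma serves twice: for [adj], and for the claim that a
    given set only appears, or only disappears, while [v] climbs. *)
Lemma climb_sorted (r : rel (seq T)) v W :
  (forall a y b, W = a ++ y :: b -> r (a ++ v :: y :: b) (a ++ y :: v :: b)) ->
  sorted r (climb v W).
Proof.
elim: W r => [//|y W IH] r h /=.
have : sorted (relpre (cons y) r) (climb v W).
  by apply: IH => a z b eW; apply: (h (y :: a)); rewrite eW.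
rewrite -sorted_map; have := h [::] y W erefl.
by case: W {IH h} => [|z W] /= -> //= ->.
Qed.

Lemma climbP v W w :
  w \in climb v W -> exists a b, W = a ++ b /\ w = a ++ v :: b.
Proof.
elim: W w => [|y W IH] w /=; rewrite inE.
  by move=> /eqP->; exists [::], [::].
case/predU1P => [->|]; first by exists [::], (y :: W).
by move=> /mapP[w' /IH[a [b [-> ->]]] ->]; exists (y :: a), b.
Qed.

Lemma last_climb v W w0 : last w0 (climb v W) = rcons W v.
Proof.
elim: W w0 => [//|y W IH] w0 /=.
by rewrite (last_map_neq0 _ _ [::]) ?IH //; case: (W).
Qed.

(** [W] is meant to be the last word of [s1] and the first of [s2]: [v] stands in front during [s1],
    climbs through [W], and stays at the end during [s2]. *)
Definition glue v s1 W s2 :=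
  map (cons v) s1 ++ climb v W ++ map (rcons^~ v) s2.

Definition walk U S E s :=
  [/\ head [::] s = S, last [::] s = E, sorted adj s, s != [::]
    & {in s, forall w, uniq w /\ w =i U}].

Lemma walk_rev U S E s : walk U S E s -> walk U E S (rev s).
Proof.
case=> hS hE ss s0 ws; split.
- by case/lastP: s hE {hS ss s0 ws} => //= s x; rewrite rev_rcons last_rcons.
- by case: s hS {hE ss s0 ws} => //= x s ->; rewrite rev_cons last_rcons.
- by rewrite rev_sorted; under eq_sorted => x y do rewrite adj_sym.
- by rewrite -size_eq0 size_rev size_eq0.
- by move=> w; rewrite mem_rev => /ws.
Qed.

Lemma walk_cons U S E s v :
  v \notin U -> walk U S E s -> walk (v |: U) (v :: S) (v :: E) (map (cons v) s).
Proof.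
move=> vU [hS hE ss s0 ws]; split.
- by case: s s0 hS {hE ss ws} => //= x s _ ->.
- by case: s s0 hE {hS ss ws} => //= x s _; rewrite last_map => ->.
- by rewrite sorted_map; apply: sub_sorted ss => w w'; apply: adj_cons.
- by case: (s) s0.
- move=> _ /mapP[w /ws[uw wU] ->]; rewrite /= uw wU vU; split=> // z.
  by rewrite !inE wU.
Qed.

Lemma walk_glue U S W E s1 s2 v :
  v \notin U -> walk U S W s1 -> walk U W E s2 ->
  walk (v |: U) (v :: S) (rcons E v) (glue v s1 W s2).
Proof.
move=> vU w1 w2; have [hS1 hE1 ss1 s10 ws1] := walk_cons vU w1.
have [hS hE ss s0 ws] := w2.
have hW : uniq W /\ W =i U.
  by apply: ws; rewrite -hS; case: (s2) s0 => //= x s _; rewrite mem_head.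
split.
- by rewrite /glue; case: (map _ s1) s10 hS1.
- by rewrite /glue !last_cat (last_map_neq0 _ _ [::]) ?hE.
- apply: (@sorted_join _ _ [::]) => //; last first.
    by rewrite hE1; case: (W) => [|y W'] /=; apply: adj_refl.
  apply: (@sorted_join _ _ [::]).
  + by apply: climb_sorted => a y b _; apply: adj_swap.
  + by rewrite sorted_map; apply: sub_sorted ss => w w'; apply: adj_rcons.
  + rewrite last_climb; case: (s2) s0 hS => //= x _ _ ->; exact: adj_refl.
- by rewrite /glue; case: (map _ s1) s10.
- move=> w; rewrite !mem_cat => /or3P[/ws1//|/climbP[a [b [eW ->]]]|].
    case: hW; rewrite eW => uW mW; split.
      by rewrite (perm_uniq (permEl (perm_catCA a [:: v] b))) /= uW mW vU.
    by move=> z; rewrite mem_cat !inE -mW mem_cat orbCA.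
  move=> /mapP[w' /ws[uw wU] ->]; rewrite rcons_uniq uw wU vU.
  by split=> // z; rewrite mem_rcons !inE wU.
Qed.

(** Moving [v] to the right can only put letters of [Y] before it, so the property can only be lost
    during the climb, and it fails once [v] is last. *)
Lemma glue_in v s1 W s2 X Y :
  last [::] s1 = W -> s1 != [::] -> s2 != [::] ->
  v \in X -> v \notin Y ->
  unimodal [seq before (v :: w) X Y | w <- s1] ->
  {in s2, forall w, ~~ before (rcons w v) X Y} ->
  unimodal [seq before w X Y | w <- glue v s1 W s2].
Proof.
move=> eW s10 s20 vX vY u1 n2; rewrite !map_cat -!map_comp.
apply: unimodal_cat_fall => //.
  apply: (@sorted_join _ _ false).
  - rewrite sorted_map; apply: climb_sorted => a y b _ /=; apply/implyP.
    by apply: before_swap; rewrite (negPf vY) andbF.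
  - exact: (@sorted_fall_false _ (fun w => before (rcons w v) X Y)).
  - by case: (s2) s20 n2 => //= x ? _ n2; rewrite (negPf (n2 x (mem_head _ _))).
rewrite (last_map_neq0 _ _ [::]) // eW.
by case: (W) => [|y W'] /=; apply: implybb.
Qed.

(** As [v] is not in [X], moving it to the right can only create the property. The rise over the
    first two phases is then continued by the interval in [s2]. *)
Lemma glue_out v s1 W s2 X Y :
  last [::] s1 = W -> head [::] s2 = W -> s1 != [::] -> s2 != [::] ->
  v \notin X ->
  sorted implb [seq before (v :: w) X Y | w <- s1] ->
  unimodal [seq before (rcons w v) X Y | w <- s2] ->
  unimodal [seq before w X Y | w <- glue v s1 W s2].
Proof.
move=> eW eW2 s10 s20 vX r1 u2; rewrite !map_cat -!map_comp catA.
apply: unimodal_cat_rise => //.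
  apply: (@sorted_join _ _ false) => //.
  - rewrite sorted_map; apply: climb_sorted => a y b _ /=; apply/implyP.
    by apply: before_swap; rewrite (negPf vX).
  - rewrite (last_map_neq0 _ _ [::]) // eW.
    by case: (W) => [|y W'] /=; apply: implybb.
rewrite last_cat.
have -> z : last z [seq before w X Y | w <- climb v W] = before (rcons W v) X Y.
  by rewrite (last_map_neq0 _ _ [::]) ?last_climb //; case: (W).
by case: (s2) s20 eW2 => //= x ? _ ->; apply: implybb.
Qed.

(** * Strips: lists of words controlled by their initial segments *)

Definition initial w X := before w X (~: X).

Lemma initial_cons v w X :
  v \notin w -> v \in X -> X \subset v |: [set x in w] ->
  initial (v :: w) X = initial w (X :\ v).
Proof.
move=> vw vX /subsetP Xw; apply/beforeP/beforeP => h x y.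
  rewrite !inE => /andP[xv xX]; rewrite negb_and negbK.
  have [-> _|yv /= yX] := eqVneq y v.
    rewrite (memNindex vw) index_mem; have := Xw x xX.
    by rewrite !inE (negPf xv).
  have := h x y xX; rewrite inE => /(_ yX) /=.
  by rewrite ![v == _]eq_sym (negPf xv) (negPf yv).
rewrite inE /= => xX yX.
have yv : y != v by apply: contraNneq yX => ->.
rewrite ![v == _]eq_sym (negPf yv).
have [//|xv] := eqVneq x v.
by rewrite ltnS; apply: h; rewrite !inE ?xv ?xX ?(negPf yX) ?andbF.
Qed.

Lemma initial0 w : initial w set0.
Proof. by apply/beforeP => x y; rewrite inE. Qed.

Lemma initial_full w X : w =i X -> initial w X.
Proof.
move=> wX; apply/beforeP => x y; rewrite inE -!wX => xw yw.
by rewrite (memNindex yw) index_mem.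
Qed.

Lemma initialN_cons v w X : v \notin X -> X != set0 -> ~~ initial (v :: w) X.
Proof.
move=> vX /set0Pn[x xX]; apply/beforeP => /(_ x v xX); rewrite inE => /(_ vX).
by rewrite /= eqxx.
Qed.

Lemma set_take_insert k a v b :
  [set x in take k (a ++ v :: b)] =
  if k <= size a then [set x in take k (a ++ b)]
  else v |: [set x in take k.-1 (a ++ b)].
Proof.
apply/setP => z; rewrite !take_cat; case: ltngtP => [ka|ka|->] /=.
- by [].
- rewrite !inE !mem_cat; case: ltnP => [|_].
    by case: k ka => //= k; rewrite ltnS => /leq_ltn_trans/[apply]; rewrite ltnn.
  by case: k ka => //= k; rewrite ltnS => ka; rewrite subSn //= !inE mem_cat orbCA.
- by rewrite subnn !take0 inE.
Qed.

(** For [C] the connectedness of [v |: X], the clause on initial segments is what later identifies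
    the tubes containing [v] with initial segments when [v] is put in front. *)
Definition strip U (C : pred {set T}) S E := exists s,
  [/\ walk U S E s,
      {in s, forall w k, C [set x in take k w]}
    & forall X, X \subset U -> C X -> unimodal [seq initial w X | w <- s]].

Lemma strip_rev U C S E : strip U C S E -> strip U C E S.
Proof.
move=> [s [ws cs us]]; exists (rev s); split; first exact: walk_rev.
  by move=> w; rewrite mem_rev => /cs.
by move=> X XU CX; rewrite map_rev; apply/unimodal_rev/us.
Qed.

Lemma strip_eq U C C' S E :
  (forall X, X \subset U -> C X = C' X) -> strip U C S E -> strip U C' S E.
Proof.
move=> eC [s [ws cs us]]; exists s; split=> //.
  move=> w wns k; rewrite -eC ?cs //; apply/subsetP => x; rewrite inE.
  by move=> /mem_take; case: ws => _ _ _ _ /(_ w wns)[_ ->].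
by move=> X XU; rewrite -eC //; apply: us.
Qed.

Lemma set_consE v w U : w =i U -> (v |: [set x in w]) = v |: U.
Proof. by move=> wU; apply/setP => z; rewrite !inE wU. Qed.

Lemma strip_cons U C S E v :
  v \notin U -> strip U C S E ->
  strip (v |: U) (fun X => (X == set0) || (v \in X) && C (X :\ v))
        (v :: S) (v :: E).
Proof.
move=> vU [s [ws cs us]]; have w' := walk_cons vU ws.
have [_ _ _ s0 ms] := ws; exists (map (cons v) s); split=> //.
  move=> _ /mapP[w wns ->] [|k] /=.
    by apply/orP; left; apply/eqP/setP => z; rewrite !inE.
  have [_ wU] := ms _ wns; apply/orP; right; rewrite inE mem_head /=.
  suff -> : [set x in v :: take k w] :\ v = [set x in take k w] by apply: cs.
  apply/setP => z; rewrite !inE; have [->|//] := eqVneq z v.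
  by apply/esym/negbTE; apply: contra vU => /mem_take; rewrite wU.
move=> X XU /orP[/eqP->|/andP[vX CX]].
  by apply: unimodal_true => [|w _]; [case: w' | apply: initial0].
have XvU : X :\ v \subset U by rewrite subDset.
rewrite -map_comp (eq_in_map _ (fun w => initial w (X :\ v)) _).1; first exact: us.
move=> w /ms[_ wU] /=; apply: initial_cons => //; first by rewrite wU.
by rewrite (set_consE _ wU).
Qed.

(** Sets containing [v] have their interval begin in the first strip, while [v] is in front, and are
    lost by the end of the climb. Sets avoiding [v] appear during the climb or in the second strip.
    The full set and the empty set are always initial and are treated apart. *)
Lemma strip_glue U C0 C1 S W E v :
  v \notin U -> strip U C1 S W -> strip U C0 W E ->
  strip (v |: U) (fun X => if v \in X then C1 (X :\ v) else C0 X)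
        (v :: S) (rcons E v).
Proof.
move=> vU [s1 [ws1 cs1 us1]] [s2 [ws2 cs2 us2]].
have wg := walk_glue vU ws1 ws2.
have [_ e1 _ s10 ms1] := ws1; have [e2 _ _ s20 ms2] := ws2.
have W1 : W \in s1.
  by rewrite -e1; case: (s1) s10 => //= x s _; apply: mem_last.
have W2 : W \in s2.
  by rewrite -e2; case: (s2) s20 => //= x s _; apply: mem_head.
have C1U : C1 U.
  have := cs1 _ W1 (size W); rewrite take_size; suff -> : [set x in W] = U by [].
  by apply/setP => z; rewrite inE (ms1 _ W1).2.
have C00 : C0 set0.
  have := cs2 _ W2 0; suff -> : [set x in take 0 W] = set0 by [].
  by apply/setP => z; rewrite !inE take0.
pose C (X : {set T}) := if v \in X then C1 (X :\ v) else C0 X.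
have eC1 w k : w =i U -> C1 [set x in take k w] ->
    C (v |: [set x in take k w]).
  move=> wU; rewrite /C setU11 setU1K // inE.
  by apply: contra vU => /mem_take; rewrite wU.
have eC0 w k : w =i U -> C0 [set x in take k w] ->
    C [set x in take k w].
  move=> wU; rewrite /C inE ifN //.
  by apply: contra vU => /mem_take; rewrite wU.
have Cg : {in glue v s1 W s2, forall w k, C [set x in take k w]}.
  move=> w; rewrite !mem_cat => /or3P[/mapP[w' wns ->]|/climbP[a [b [eW ->]]]|/mapP[w' wns ->]] k.
  - rewrite (set_take_insert k [::] v w') leqn0 /=; case: eqP => [->|_].
      suff -> : [set x in take 0 w'] = set0 by rewrite /C inE.
      by apply/setP => z; rewrite !inE take0.
    by apply: eC1; [exact: (ms1 _ wns).2 | exact: cs1].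
  - rewrite set_take_insert -eW; case: ifP => _.
      by apply: eC0; [exact: (ms2 _ W2).2 | exact: cs2].
    by apply: eC1; [exact: (ms1 _ W1).2 | exact: cs1].
  - rewrite -cats1 set_take_insert cats0; case: leqP => kw.
      by apply: eC0; [exact: (ms2 _ wns).2 | exact: cs2].
    rewrite take_oversize; last by case: k kw.
    by rewrite (set_consE _ (ms2 _ wns).2) /C setU11 setU1K.
exists (glue v s1 W s2); split=> //.
move=> X XU; case: ifP => vX CX.
  have [->|XnU] := eqVneq X (v |: U).
    apply: unimodal_true; first by case: wg.
    by case: wg => _ _ _ _ h w /h[_ wU]; apply: initial_full.
  apply: glue_in => //; first by rewrite inE vX.
    rewrite (eq_in_map _ (fun w => initial w (X :\ v)) _).1.
      by apply: us1; rewrite ?subDset.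
    move=> w /ms1[_ wU]; apply: initial_cons => //; first by rewrite wU.
    by rewrite (set_consE _ wU).
  move=> w /ms2[_ wU].
  have /properP[_ [y]] : X \proper v |: U by rewrite properEneq XnU.
  rewrite !inE => /orP[/eqP->|yU yX]; first by rewrite vX.
  by apply: (@before_rconsN _ _ y); rewrite ?inE ?wU.
have [->|X0] := eqVneq X set0.
  by apply: unimodal_true => [|w _]; [case: wg | apply: initial0].
have XU' : X \subset U.
  apply/subsetP => z zX; have := subsetP XU z zX; rewrite !inE.
  by case/orP => // /eqP ez; rewrite -ez zX in vX.
apply: glue_out; rewrite ?vX //.
  apply: (@sorted_rise_false _ (fun w => initial (v :: w) X)) => w _.
  by apply: initialN_cons; rewrite ?vX.
rewrite (eq_in_map _ (fun w => initial w X) _).1; first exact: us2.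
move=> w /ms2[_ wU]; apply: before_rcons => x xX; rewrite wU.
exact: (subsetP XU').
Qed.

(** The case of all subsets, which corresponds to the permutohedron. The strip for the remaining
    letters is run forwards with [x] in front and backwards with [x] at the end, so it closes up to
    a rotation. *)
Lemma strip_perm w : uniq w -> strip [set x in w] predT w (rot 1 w).
Proof.
elim: w => [_|x w IH] /=.
  exists [:: [::]]; split=> //.
    by split=> // w; rewrite inE => /eqP->; split=> // z; rewrite !inE.
  move=> X; rewrite (_ : [set x in [::]] = set0); last by apply/setP => z; rewrite !inE.
  rewrite subset0 => /eqP-> _; apply: (@unimodal_true _ (fun w => initial w set0)) => // w _.
  exact: initial0.
move=> /andP[xw /IH sw]; rewrite rot1_cons.
have xU : x \notin [set y in w] by rewrite inE.
have -> : [set y in x :: w] = x |: [set y in w].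
  by apply/setP => z; rewrite !inE.
apply: strip_eq (strip_glue xU sw (strip_rev sw)) => X _ /=.
by rewrite if_same.
Qed.

(* The shape a b..b a..a is the same at both ends: moving the last letter z of
   the first side to the front and rotating the rest gives z b..b a..a. *)
Lemma strip_bip (a : T) (bs cs : seq T) : uniq (a :: bs ++ cs) ->
  exists (a' : T) (bs' cs' : seq T),
   [/\ perm_eq bs' bs, perm_eq (a' :: cs') (a :: cs)
     & strip [set x in a :: bs ++ cs]
        (fun X => (X == set0) || [exists x in X, x \in a :: cs])
        (a :: bs ++ cs) (a' :: bs' ++ cs')].
Proof.
elim/last_ind: cs => [|cs z IH].
  rewrite cats0 /= => /andP[abs ubs]; exists a, (rot 1 bs), [::].
  rewrite cats0 perm_rot; split=> //.
  have aU : a \notin [set y in bs] by rewrite inE.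
  have -> : [set y in a :: bs] = a |: [set y in bs].
    by apply/setP => y; rewrite !inE.
  apply: strip_eq (strip_cons aU (strip_perm ubs)) => X _ /=.
  rewrite andbT; congr (_ || _); apply/idP/exists_inP => [aX|[x xX]].
    by exists a; rewrite ?inE.
  by rewrite inE => /eqP <-.
rewrite -rcons_cat -rcons_cons rcons_uniq => /andP[zU uw].
have [a' [bs' [cs' [pb pc st]]]] := IH uw.
have pw : perm_eq (a' :: bs' ++ cs') (a :: bs ++ cs).
  rewrite -(cat1s a') -(cat1s a) perm_catCA perm_sym perm_catCA perm_sym.
  exact: perm_cat.
exists z, bs', (rcons cs' a'); split=> //.
  apply: (perm_trans (y := z :: a :: cs)); last by rewrite perm_sym -rcons_cons perm_rcons.
  by rewrite perm_cons perm_rcons.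
have zU' : z \notin [set x in a :: bs ++ cs] by rewrite inE.
(* Every set containing [z] meets the first side, so while [z] is in front all subsets of the other
   letters must be covered: this is the rotation of [strip_perm], reversed. *)
have sp : strip [set x in a :: bs ++ cs] predT (bs' ++ rcons cs' a') (a' :: bs' ++ cs').
  apply: strip_rev; have := @strip_perm (a' :: bs' ++ cs').
  rewrite (perm_uniq pw) uw rot1_cons rcons_cat => /(_ isT).
  suff -> : [set x in a' :: bs' ++ cs'] = [set x in a :: bs ++ cs] by [].
  by apply/setP => x; rewrite !inE -!in_cons (perm_mem pw).
have := strip_rev (strip_glue zU' sp (strip_rev st)).
have -> : [set x in rcons (a :: bs ++ cs) z] = z |: [set x in a :: bs ++ cs].
  by apply/setP => x; rewrite inE mem_rcons !inE.
apply: strip_eq => X _; case: ifP => zX.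
  apply/esym/orP; right; apply/exists_inP; exists z => //.
  by rewrite inE mem_rcons mem_head orbT.
congr (_ || _); apply: eq_existsb_in => x xX.
have xz : x != z by apply: contraFneq zX => <-.
by rewrite -rcons_cons mem_rcons [RHS]inE (negPf xz).
Qed.

End Words.

Local Notation induced e X := [rel u v | [&& u \in X, v \in X & e u v]].

(** * Tubes kept by a word, and the insertion of a vertex *)

Section Tubes.
Variables (T : finType) (e : rel T).
Hypothesis e_sym : symmetric e.
Implicit Types (t U X Y : {set T}) (w S E : seq T).

Definition boundary t := [set y | (y \notin t) && [exists z in t, e z y]].

Lemma boundaryP t y :
  reflect (y \notin t /\ exists2 z, z \in t & e z y) (y \in boundary t).
Proof.
rewrite inE; apply: (iffP andP) => -[yt]; last by move=> h; split=> //; apply/exists_inP.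
by move/exists_inP.
Qed.

Lemma connect_exit (r : rel T) (B : pred T) x y :
  (forall u v, r u v -> B u -> B v) -> connect r x y -> B x -> B y.
Proof.
move=> h /connectP[p + ->]; elim: p x => [//|z p IH] x /= /andP[/h xz /IH {}IH].
by move=> /xz /IH.
Qed.

Lemma induced_connect_sym X : connect_sym (induced e X).
Proof. by apply: sym_connect_sym => u v /=; rewrite e_sym andbCA. Qed.

(** Otherwise membership in [t] would propagate along every path inside [X]. *)
Lemma connected_meets_boundary X t x y :
  connected_on e X -> x \in X -> x \in t -> y \in X -> y \notin t ->
  exists2 z, z \in X & z \in boundary t.
Proof.
case/andP=> _ /forall_inP cX xX xt yX yt.
have /exists_inP[z zX zb] : [exists z in X, z \in boundary t]; last by exists z.
apply: contraNT yt; rewrite negb_exists_in => /forall_inP nX.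
apply: (connect_exit _ (forall_inP (cX x xX) y yX) xt) => u v /and3P[uX vX uv] ut.
by apply: contraNT (nX v vX) => vt; apply/boundaryP; split=> //; exists u.
Qed.

Lemma connected_onS X Y x y : X \subset Y -> connect (induced e X) x y -> connect (induced e Y) x y.
Proof.
move=> /subsetP XY; apply: connect_sub => u v /and3P[uX vX uv].
by apply: connect1; rewrite /= !XY.
Qed.

Lemma connected_from X x :
  x \in X -> (forall y, y \in X -> connect (induced e X) x y) -> connected_on e X.
Proof.
move=> xX h; apply/andP; split; first by apply/set0Pn; exists x.
apply/forall_inP => y yX; apply/forall_inP => z zX.
by apply: connect_trans (h z zX); rewrite induced_connect_sym h.
Qed.

Lemma connected_edgeU X Y x y :
  connected_on e X -> connected_on e Y -> x \in X -> y \in Y ->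
  (x == y) || e x y -> connected_on e (X :|: Y).
Proof.
case/andP=> _ /forall_inP cX /andP[_ /forall_inP cY] xX yY xy.
apply: (@connected_from _ x) => [|z]; first by rewrite inE xX.
rewrite inE => /orP[zX|zY].
  exact: connected_onS (subsetUl _ _) (forall_inP (cX x xX) z zX).
apply: connect_trans (connected_onS (subsetUr _ _) (forall_inP (cY y yY) z zY)).
by case/predU1P: xy => [->//|xy]; apply: connect1; rewrite /= !inE xX yY orbT.
Qed.

Lemma connected1 x : connected_on e [set x].
Proof.
by apply: (@connected_from _ x) => [|y]; rewrite inE // => /eqP->.
Qed.

Lemma connected_component X x :
  x \in X -> connected_on e [set y | connect (induced e X) x y].
Proof.
move=> xX; set C := [set _ | _].
apply: (@connected_from _ x) => [|y]; first by rewrite inE.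
rewrite inE => /(connect_exit (B := connect (induced e C) x)); apply=> // u v /and3P[uX vX uv] xu.
have uC : connect (induced e X) x u.
  apply: connected_onS xu; apply/subsetP => z; rewrite inE.
  by move=> /(connect_exit (B := mem X)); apply=> // a b /and3P[].
apply: connect_trans xu _; apply: connect1.
rewrite /= !inE uC uv (connect_trans uC) //.
by apply: connect1; rewrite /= uX vX.
Qed.

(** The boundary is taken in the whole graph. Outer neighbours that do not occur in [w] impose
    nothing, so for words on [U] this is the condition in the subgraph induced on [U]. *)
Definition ends w t := before w t (boundary t).

Lemma in_boundaryN t x : x \in t -> x \notin boundary t.
Proof. by move=> xt; rewrite inE xt. Qed.

(** Only the first word is recorded, since the next vertex is attached at that end. The set [U]
    itself is included among the [t] when it is connected. *)
Definition facets U S := exists s,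
  [/\ head [::] s = S, sorted (@adj T) s, s != [::],
      {in s, forall w, uniq w /\ w =i U}
    & forall t, t \subset U -> connected_on e t ->
        unimodal [seq ends w t | w <- s]].

Section Prepend.
Variables (U : {set T}) (v : T) (w : seq T).
Hypotheses (vU : v \notin U) (wU : w =i U).
Hypothesis cw : forall k, connected_on e (v |: [set x in take k w]).

(** If some [y] outside [t] is listed, the segment up to [y] together with [v] is connected, hence
    contains an outer neighbour of [t] no later than [y]. Preceding all outer neighbours thus
    amounts to preceding all of the complement. *)
Lemma ends_cons_in t :
  v \in t -> t \subset v |: U -> ends (v :: w) t = initial w (t :\ v).
Proof.
move=> vt tU; have vw : v \notin w by rewrite wU.
rewrite -(initial_cons vw vt); last by rewrite (set_consE _ wU).
apply/idP/idP => /beforeP h; apply/beforeP => x y xt; last first.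
  by move=> /boundaryP[yt _]; apply: h; rewrite // inE.
rewrite inE => yt; have yv : y != v by apply: contraNneq yt => ->.
case: (boolP (y \in w)) => yw; last first.
  rewrite /= [v == y]eq_sym (negPf yv) (memNindex yw).
  have := subsetP tU x xt; rewrite !inE -wU [v == x]eq_sym.
  by case: eqP => //= _; rewrite ltnS index_mem.
have yA : y \in v |: [set z in take (index y w).+1 w].
  by rewrite !inE in_take_leq ?index_mem // leqnn orbT.
have [z] := connected_meets_boundary (cw _) (setU11 _ _) vt yA yt.
case/setU1P => [->|zy zb]; first by rewrite (negPf (in_boundaryN vt)).
apply: leq_trans (h x z xt zb) _ => /=.
have zv : z != v by apply: contraTneq zb => ->; apply: in_boundaryN.
rewrite ![v == _]eq_sym (negPf yv) (negPf zv) ltnS.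
by rewrite inE in zy; move: zy; rewrite in_take_leq ?index_mem // ltnS.
Qed.

(** The segment up to a vertex [x] of [t], together with [v], is connected and leaves [t], so an
    outer neighbour of [t] comes before [x]. *)
Lemma ends_cons_out t : v \notin t -> t \subset U -> t != set0 -> ~~ ends (v :: w) t.
Proof.
move=> vt /subsetP tU /set0Pn[x xt]; apply/beforeP => h.
have xw : x \in w by rewrite wU tU.
have xA : x \in v |: [set z in take (index x w).+1 w].
  by rewrite !inE in_take_leq ?index_mem // leqnn orbT.
have [z] := connected_meets_boundary (cw _) xA xt (setU11 _ _) vt.
move=> zA zb; have := h x z xt zb; rewrite /= [v == x]eq_sym.
have -> : x == v = false by apply: contraNF vt => /eqP <-.
case: eqP => // vz; rewrite ltnS.
case/setU1P: zA => [/esym//|]; rewrite inE in_take_leq ?index_mem // !ltnS.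
by rewrite leqNgt => /negPf->.
Qed.

End Prepend.

(* The list for U need not start where the strip ends: the first two letters
   r x of S may have to be exchanged.  With v in front this trades only the tube
   {v, r} for {x}, so it is harmless. *)
Definition link v S S0 := S0 = S \/ exists r x q,
  [/\ S = r :: x :: q, S0 = x :: r :: q, e v r & ~~ e v x].

(** The strip is run backwards from [E] to [S] with [v] in front, then [v] climbs through [S0], then
    the list for [U] runs with [v] at the end. *)
Lemma facets_step U v S E S0 :
  v \notin U -> strip U (fun Y => connected_on e (v |: Y)) S E ->
  facets U S0 -> link v S S0 -> facets (v |: U) (v :: E).
Proof.
move=> vU [s1 [ws1 cs1 us1]] [s2 [hS0 ss2 s20 ms2 us2]] lk.
have [eS eE ss1 s10 ms1] := ws1.
have [S1 S01] : S \in s1 /\ S0 \in s2.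
  rewrite -eS -hS0; case: (s1) s10 => //= ? ? _; case: (s2) s20 => //= ? ? _.
  by rewrite !mem_head.
have [uS mS] := ms1 _ S1.
(* [S0] is appended even when it equals [S]; the repetition is harmless because [adj] is
   reflexive. *)
have wL : walk U E S0 (rcons (rev s1) S0).
  have [e1 e2 e3 e4 e5] := walk_rev ws1; split.
  - by case: (rev s1) e1 e4.
  - by rewrite last_rcons.
  - rewrite -cats1; apply: (@sorted_join _ _ [::]) => //=; rewrite e2.
    by case: lk => [->|[r [x [q [-> -> _ _]]]]]; [apply: adj_refl | apply: (adj_swap [::])].
  - by case: (rev s1).
  - by move=> w; rewrite mem_rcons inE => /predU1P[->|/e5//]; apply: ms2.
have wR : walk U S0 (last [::] s2) s2 by [].
have wg := walk_glue vU wL wR.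
exists (glue v (rcons (rev s1) S0) S0 s2).
have [g1 _ g3 g4 g5] := wg; split=> // t tU ct.
have cU : connected_on e (v |: U).
  have := cs1 _ S1 (size S); rewrite take_size.
  by rewrite (set_consE _ mS).
have t0 : t != set0 by case/andP: ct.
case: (boolP (v \in t)) => vt.
  have [->|tnU] := eqVneq t (v |: U).
    apply: unimodal_true => // w /g5[_ wU]; apply/beforeP => x y xU.
    case/boundaryP => yU _; rewrite -!wU in xU yU.
    by rewrite (memNindex yU) index_mem.
  have /properP[_ [y yU yt]] : t \proper v |: U by rewrite properEneq tnU.
  apply: glue_in => //.
  - by rewrite last_rcons.
  - by case: (rev s1).
  - exact: in_boundaryN.
  - rewrite map_rcons -cats1; apply: unimodal_cat_fall => //=.
      rewrite map_rev; apply: unimodal_rev.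
      rewrite (eq_in_map _ (fun w => initial w (t :\ v)) _).1.
        by apply: us1; rewrite ?subDset // setD1K.
      move=> w wns; apply: (@ends_cons_in U) => //; first exact: (ms1 _ wns).2.
      exact: cs1.
    rewrite (last_map_neq0 _ _ [::]); last by have [] := walk_rev ws1.
    have [_ -> _ _ _] := walk_rev ws1; apply/implyP.
    case: lk => [->//|[r [x [q [eS' -> vr vx]]]]]; rewrite eS'.
    (* The exchange could only create a tube containing [x] with [r] on its boundary. Such a tube
       lies inside [v] and [x], which are not adjacent, so it is not connected. *)
    case: (boolP ((x \in t) && (r \in boundary t))) => [|n]; last first.
      exact: (@before_swap _ [:: v] x r q).
    case/andP=> xt rb /beforeP h; move: uS; rewrite eS' /= inE negb_or.
    case/andP=> /andP[rx rq] /andP[xq uq].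
    have vr' : v != r by apply: contraTneq rb => <-; apply: in_boundaryN.
    have tvx z : z \in t -> (z == v) || (z == x).
      move=> /(fun zt => h z r zt rb) /=.
      rewrite [v == r]eq_sym [r == v]eq_sym (negPf vr') [x == r]eq_sym (negPf rx) eqxx.
      by rewrite ![z == _]eq_sym; case: eqP => //=; case: eqP.
    have xv : x != v by apply: contraNneq vU => <-; rewrite -mS eS' !inE eqxx orbT.
    case/andP: ct => _ /forall_inP/(_ v vt)/forall_inP/(_ x xt) cvx.
    have := connect_exit (B := pred1 v) _ cvx; rewrite /= eqxx (negPf xv).
    move=> /(_ _ isT); suff h' : forall u z, [&& u \in t, z \in t & e u z] -> u == v -> z == v.
      by move=> /(_ h').
    move=> u z /and3P[_ /tvx/orP[//|/eqP->] uz] /eqP uv.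
    by rewrite uv (negPf vx) in uz.
  (* Since [v |: U] is connected, a proper part of it containing [v] has an outer neighbour in [U],
     and this precedes [v] once [v] is last. *)
  - move=> w /ms2[_ wU]; have [z zU zb] := connected_meets_boundary cU (setU11 _ _) vt yU yt.
    have zv : z != v by apply: contraTneq zb => ->; apply: in_boundaryN.
    apply: (@before_rconsN _ _ _ z) => //; rewrite wU //.
    by move: zU; rewrite !inE (negPf zv).
have tU' : t \subset U.
  apply/subsetP => z zt; have := subsetP tU z zt; rewrite !inE.
  by case/orP => // /eqP ez; rewrite -ez zt in vt.
apply: glue_out => //.
- by rewrite last_rcons.
- by case: (rev s1).
- rewrite map_rcons -cats1; apply: (@sorted_join _ _ false) => //=.
    apply: (@sorted_rise_false _ (fun w => ends (v :: w) t)) => w.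
    rewrite mem_rev => wns; apply: (@ends_cons_out U) => //; first exact: (ms1 _ wns).2.
    exact: cs1.
  rewrite (last_map_neq0 _ _ [::]); last by have [] := walk_rev ws1.
  have [_ -> _ _ _] := walk_rev ws1; apply/implyP.
  rewrite -/(ends _ _) => h; suff : ~~ ends (v :: S) t by rewrite h.
  by apply: (@ends_cons_out U) => //; exact: cs1.
rewrite (eq_in_map _ (fun w => ends w t) _).1; first exact: us2.
move=> w /ms2[_ wU]; apply: before_rcons => x xt; rewrite wU.
exact: (subsetP tU').
Qed.

(** Outer neighbours of a nonempty part of [U] lie outside [U], hence are absent from [w], and the
    single word [w] keeps every tube. *)
Lemma facets_discrete U w : uniq w -> w =i U ->
  {in U &, forall x y, ~~ e x y} -> facets U w.
Proof.
move=> uw wU nU; exists [:: w]; split=> // [w'|t tU ct].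
  by rewrite inE => /eqP->.
apply: (@unimodal_true _ (fun w => ends w t)) => // w'; rewrite inE => /eqP->.
apply/beforeP => x y /(subsetP tU) xU /boundaryP[_ [z /(subsetP tU) zU zy]].
have yw : y \notin w by rewrite wU; apply: contraTN zy => yU; apply: nU.
by rewrite (memNindex yw) index_mem wU.
Qed.

(** * The maximal tubing of a word, and its flips *)

Definition tubes_of w := [set t | tube e t && ends w t].

Lemma tubes_ofP w t : reflect (tube e t /\ ends w t) (t \in tubes_of w).
Proof. by rewrite inE; apply: andP. Qed.

(** If neither contained the other, the connected union would have a vertex of [t2] on the boundary
    of [t1] and a vertex of [t1] on the boundary of [t2]; each would precede the other in [w]. *)
Lemma tubes_of_nested w t1 t2 :
  t1 \in tubes_of w -> t2 \in tubes_of w -> connected_on e (t1 :|: t2) ->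
  (t1 \subset t2) || (t2 \subset t1).
Proof.
move=> /tubes_ofP[_ /beforeP b1] /tubes_ofP[_ /beforeP b2] c12.
apply: contraT; rewrite negb_or => /andP[/subsetPn[x x1 x2] /subsetPn[y y2 y1]].
have xU : x \in t1 :|: t2 by rewrite inE x1.
have yU : y \in t1 :|: t2 by rewrite inE y2 orbT.
have [z zU z1] := connected_meets_boundary c12 xU x1 yU y1.
have [z' zU' z2] := connected_meets_boundary c12 yU y2 xU x2.
have zt2 : z \in t2 by case/setUP: zU z1 => // /in_boundaryN/negPf->.
have zt1 : z' \in t1 by case/setUP: zU' z2 => // /in_boundaryN/negPf->.
by have := ltn_trans (b1 _ _ zt1 z1) (b2 _ _ zt2 z2); rewrite ltnn.
Qed.

Lemma tubing_tubes_of w : tubing e (tubes_of w).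
Proof.
apply/andP; split; first by apply/forall_inP => t /tubes_ofP[].
apply/forall_inP => t1 h1; apply/forall_inP => t2 h2; apply/implyP => n12.
apply: contraT; rewrite !negb_or negbK => /and3P[p12 p21 /(tubes_of_nested h1 h2)].
by case/orP => s12; [move: p12 | move: p21]; rewrite properEneq s12 andbT negbK;
  move=> /eqP e12; rewrite e12 eqxx in n12.
Qed.

(* A tube t outside the tubing of w has an element x listed after a neighbour y
   of t; the component of y among the vertices listed before x is then a member
   of the tubing of w that is incompatible with t. *)
Lemma tubes_of_max w : w =i [set: T] -> maxset (tubing e) (tubes_of w).
Proof.
move=> wT; apply/maxsetP; split; first exact: tubing_tubes_of.
move=> Y /andP[/forall_inP tY /forall_inP cY] /subsetP wY; apply/setP => t.
apply/idP/idP => [tt|/wY//]; apply: contraT; rewrite inE (tY t tt) /=.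
move=> /beforeP h; exfalso; apply: h => x y xt yb; rewrite ltnNge; apply/negP => yx.
have [yt [z zt ezy]] := boundaryP _ _ yb.
have {}yx : index y w < index x w.
  rewrite ltn_neqAle yx andbT; apply: contraNneq yt => eyx.
  have yw : y \in w by rewrite wT inE.
  by rewrite -(nth_index y yw) eyx nth_index ?wT ?inE.
pose P := [set z | index z w < index x w].
have yP : y \in P by rewrite inE.
pose C := [set z | connect (induced e P) y z].
have CP u : u \in C -> u \in P.
  rewrite inE => /(connect_exit (B := mem P)); apply=> // a b /and3P[] //.
have cC : connected_on e C := connected_component yP.
have xC : x \notin C by apply/negP => /CP; rewrite inE ltnn.
have yC : y \in C by rewrite inE.
have CT : C \in tubes_of w.
  apply/tubes_ofP; split.
    by apply/andP; split=> //; apply/properP; split; [apply: subsetT | exists x].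
  apply/beforeP => u b uC /boundaryP[bC [c cC' ecb]].
  have /CP := uC; rewrite inE => /leq_trans; apply; rewrite leqNgt.
  apply: contra bC => bx; rewrite inE; have cP := CP c cC'.
  rewrite inE in cC'; apply: connect_trans cC' _; apply: connect1.
  by rewrite /= ecb cP inE bx.
have tC : t != C by apply: contraNneq xC => <-.
have /forall_inP/(_ C (wY _ CT)) := cY t tt; rewrite tC => /or3P[||].
- by case/properP => /subsetP/(_ x xt); rewrite (negPf xC).
- by case/properP => /subsetP/(_ y yC); rewrite (negPf yt).
- have /andP[_ ct] := tY t tt.
  by rewrite (connected_edgeU ct cC zt yC) // ezy orbT.
Qed.

(** A lost tube contains [x] and has [y] on its boundary. Two such tubes share [x], hence are
    nested; were they distinct, the larger would contain an outer neighbour of the smaller, listed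
    strictly between the consecutive letters [x] and [y]. *)
Lemma tubes_of_swap a x y b :
  uniq (a ++ x :: y :: b) ->
  #|tubes_of (a ++ x :: y :: b) :\: tubes_of (a ++ y :: x :: b)| <= 1.
Proof.
move=> uw; set w := a ++ _; apply: contraT; rewrite -ltnNge => /card_gt1P[t1 [t2 []]].
have key t : t \in tubes_of w :\: tubes_of (a ++ y :: x :: b) ->
  [/\ t \in tubes_of w, x \in t & y \in boundary t].
  case/setDP => tw; rewrite inE; have /tubes_ofP[-> et] := tw; rewrite /= => n.
  suff /andP[] : (x \in t) && (y \in boundary t) by [].
  by apply: contraR n => n; apply: before_swap et.
have sub t t' : t \in tubes_of w -> x \in t -> y \in boundary t ->
    t' \in tubes_of w -> x \in t' -> y \in boundary t' -> t \subset t' -> t = t'.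
  move=> /tubes_ofP[/andP[_ ct] /beforeP bt] xt yt.
  move=> /tubes_ofP[/andP[_ ct'] /beforeP bt'] xt' yt' tt'.
  apply/eqP; rewrite eqEsubset tt'; apply/subsetP => z zt'; apply: contraT => zt.
  have [u ut' ub] := connected_meets_boundary ct' xt' xt zt' zt.
  have := bt x u xt ub; have := bt' u y ut' yt'.
  move: uw; rewrite cat_uniq => /and3P[_ /hasPn ax] /=.
  rewrite inE negb_or => /andP[/andP[xy _] _].
  have [xa ya] : x \notin a /\ y \notin a by rewrite !ax // !inE eqxx ?orbT.
  rewrite !index_cat (negPf xa) (negPf ya) /= !eqxx (negPf xy) addn0 addn1 ltnS.
  by move=> /leq_ltn_trans/[apply]; rewrite ltnn.
move=> /key[h1 x1 y1] /key[h2 x2 y2]; apply: contraNT => _; apply/eqP.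
have /tubes_ofP[/andP[_ c1] _] := h1; have /tubes_ofP[/andP[_ c2] _] := h2.
have := tubes_of_nested h1 h2 (connected_edgeU c1 c2 x1 x2 _).
by rewrite eqxx => /(_ isT)/orP[] /sub; [|symmetry]; auto.
Qed.

(** Each difference has at most one element, and by maximality neither tubing contains the other
    unless they are equal. *)
Lemma tubes_of_adj w w' : uniq w -> w =i [set: T] -> adj w w' ->
  tubes_of w = tubes_of w' \/
  (#|tubes_of w :\: tubes_of w'| == 1) && (#|tubes_of w' :\: tubes_of w| == 1).
Proof.
move=> uw wT /adjP[->|[a [x [y [b [ew ew']]]]]]; first by left.
have pw : perm_eq w w' by rewrite ew ew' perm_cat2l (perm_catCA [:: x] [:: y] b).
have w'T : w' =i [set: T] by move=> z; rewrite -(perm_mem pw).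
have uw' : uniq w' by rewrite -(perm_uniq pw).
have d1 : #|tubes_of w :\: tubes_of w'| <= 1.
  by rewrite ew ew'; apply: tubes_of_swap; rewrite -ew.
have d2 : #|tubes_of w' :\: tubes_of w| <= 1.
  by rewrite ew ew'; apply: tubes_of_swap; rewrite -ew'.
have [/maxsetP[_ m]] := (tubes_of_max wT, tubes_of_max w'T).
have /maxsetP[_ m'] := tubes_of_max w'T.
case: (eqVneq (tubes_of w) (tubes_of w')) => [|n]; [by left | right].
rewrite !eqn_leq d1 d2 /= !card_gt0 !setD_eq0.
apply/andP; split; apply: contra n => s.
  by rewrite (m _ (tubing_tubes_of w') s).
by rewrite (m' _ (tubing_tubes_of w) s).
Qed.

Definition face_of w := Face (tubing_tubes_of w).

End Tubes.

(** * From lists of words to paths in the skeleton *)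

Section Undup.
Variable A : eqType.
Implicit Types (x y a b : A) (s : seq A).

Lemma undup_head y s :
  (forall a b, subseq [:: a; b; a] (y :: s) -> b = a) ->
  exists u, undup (y :: s) = y :: u.
Proof.
elim: s => [|z s IH] h; first by exists [::].
case: (boolP (y \in z :: s)) => ys; last first.
  by exists (undup (z :: s)); rewrite [LHS]/= (negPf ys).
have zy : z = y.
  move: ys; rewrite inE => /predU1P[->//|ys]; apply: h => /=.
  by rewrite !eqxx sub1seq.
rewrite [undup _]/= ys -/(undup (z :: s)) zy; apply: IH => a b ab; apply: h.
by apply: subseq_trans ab _; rewrite zy; apply: subseq_cons.
Qed.

(** No entry recurs after a different one, so equal entries are contiguous, and [undup] merely
    deletes the steps that stay in place. *)
Lemma sorted_undup (r : rel A) s :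
  (forall a b, subseq [:: a; b; a] s -> b = a) ->
  sorted (fun a b => (a == b) || r a b) s -> sorted r (undup s).
Proof.
elim: s => [//|x [//|y s] IH] h sr.
have h' a b : subseq [:: a; b; a] (y :: s) -> b = a.
  by move=> ab; apply: h; apply: subseq_trans ab (subseq_cons _ _).
have {}IH : sorted r (undup (y :: s)) by apply: IH => //; case/andP: sr.
have [u eu] := undup_head h'.
case: (boolP (x \in y :: s)) => xs.
  by rewrite [undup _]/= xs -/(undup (y :: s)).
rewrite [undup _]/= (negPf xs) -/(undup (y :: s)); rewrite eu in IH *.
rewrite /= in IH *; rewrite IH andbT; case/andP: sr => /predU1P[exy|//].
by rewrite exy mem_head in xs.
Qed.

End Undup.

Lemma segment_connected (A : finType) (P : seq A) (p : pred A) :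
  has p P -> (forall a b c, subseq [:: a; b; c] P -> p a -> p c -> p b) ->
  connected_on (consecutive P) [set v in P | p v].
Proof.
move=> /hasP[x0 x0P px0] cp; apply/andP; split.
  by apply/set0Pn; exists x0; rewrite inE x0P.
set B := [set v in P | p v]; set r := (X in connect X).
have rE u v : r u v = [&& u \in B, v \in B & consecutive P u v] by [].
have rsym : connect_sym r.
  apply: sym_connect_sym => u v; rewrite !rE andbCA; do 2!congr (_ && _).
  exact: orbC.
have key P2 P1 x y P3 : P = P1 ++ x :: P2 ++ y :: P3 -> p x -> p y -> connect r x y.
  elim: P2 P1 x => [|z P2 IH] P1 x eP px py.
    apply: connect1; rewrite rE !inE px py eP !mem_cat !inE !eqxx !orbT andTb.
    by apply/orP; left; apply/infixP; exists P1, P3.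
  have pz : p z.
    apply: (cp x z y) => //; rewrite eP; apply: (@subseq_trans _ (x :: (z :: P2) ++ y :: P3)).
      by rewrite /= !eqxx sub1seq mem_cat mem_head orbT.
    exact: suffix_subseq.
  apply: (connect_trans (y := z)); last by apply: (IH (rcons P1 x)); rewrite ?cat_rcons.
  apply: connect1; rewrite rE !inE px pz eP !mem_cat !inE !eqxx !orbT andTb.
  by apply/orP; left; apply/infixP; exists P1, (P2 ++ y :: P3).
apply/forall_inP => x; rewrite inE => /andP[xP px].
apply/forall_inP => y; rewrite inE => /andP[yP py].
case/splitPr: {1}P / xP (erefl P) yP => P1 P2 eP.
rewrite -eP mem_cat inE => /or3P[yP|/eqP->|yP]; last 2 first.
- exact: connect0.
- by case/splitPr: yP eP => Q1 Q2 eP; apply: (key Q1 P1 x y Q2).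
case/splitPr: yP eP => Q1 Q2 eP; rewrite rsym.
by apply: (key Q2 Q1 y x P2) => //; rewrite -eP -catA.
Qed.

Lemma facets_path (T : finType) (e : rel T) (S : seq T) :
  symmetric e -> facets e [set: T] S ->
  exists P : seq (graph_associahedron e), facet_hamiltonian_path P.
Proof.
move=> e_sym [s [_ ss s0 ms us]]; pose Q := map (face_of e) s.
have vQ : {in Q, forall X, vertex X}.
  by move=> _ /mapP[w /ms[_ wT] ->]; rewrite vertexE; apply: tubes_of_max.
have facetQ (f : graph_associahedron e) : facet f -> exists2 t,
    (forall v : graph_associahedron e, (v <= f)%O = (t \in val v)) &
    unimodal [seq t \in tubing_of_face v | v <- Q].
  move=> /facetP[t tt ef]; exists t => [v|]; first exact: vertex_facetE.
  have /andP[_ ct] := tt; have := us t (subsetT _) ct.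
  by rewrite -map_comp; congr (unimodal _); apply: eq_map => w; rewrite /= inE tt.
have cvx (f : graph_associahedron e) : facet f -> forall a b c,
    subseq [:: a; b; c] Q -> (a <= f)%O -> (c <= f)%O -> (b <= f)%O.
  move=> /facetQ[t ht ut] a b c abc; rewrite !ht => ta tc.
  have := map_subseq (fun v => t \in tubing_of_face v) abc.
  by rewrite /= ta tc => /(unimodal_convex ut).
(* If the list returns to [a] after [b], every tube of [a] is also in [b], as it is present during
   one interval only; maximality of [a] then gives equality. *)
have stutter a b : subseq [:: a; b; a] Q -> b = a.
  move=> aba; have aQ : a \in Q by apply: (mem_subseq aba); rewrite mem_head.
  have := vQ a aQ; rewrite vertexE => /maxsetP[_ ma]; apply/val_inj/ma.
    exact: valP.
  apply/subsetP => t ta.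
  have tt : tube e t by have /andP[/forall_inP h _] := valP a; apply: h.
  have tt1 : tubing e [set t] by rewrite tubing1.
  have ft : facet (Face tt1) by apply/facetP; exists t.
  have := cvx _ ft a b a aba; rewrite !(vertex_facetE (f := Face tt1) _ (t := t)) //.
  by apply.
exists (undup Q); split.
- case es: s s0 => [//|w s'] _.
  have : face_of e w \in undup Q by rewrite mem_undup /Q es mem_head.
  by case: undup.
- exact: undup_uniq.
- by apply/allP => X; rewrite mem_undup => /vQ.
- apply: sorted_undup => //; rewrite sorted_map.
  apply: (sub_in_sorted (P := [in s]) _ (introT allP (fun w ws => ws))) ss.
  move=> w w' ws ws' ww' /=; have [uw wT] := ms w ws.
  rewrite skeletonE !vQ ?map_f //= -val_eqE /=.
  by case: (tubes_of_adj e_sym uw wT ww') => [->|->]; rewrite ?eqxx ?orbT.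
- move=> f ff; apply: segment_connected.
    have [t ht [s1 [s2 [e12 _ _]]]] := facetQ f ff.
    have : true \in [seq t \in tubing_of_face v | v <- Q].
      by rewrite e12 mem_cat mem_head orbT.
    case/mapP=> v vns tv; apply/hasP; exists v; rewrite ?mem_undup //.
    by rewrite ht -tv.
  move=> a b c abc; apply: cvx => //.
  exact: subseq_trans abc (undup_subseq _).
Qed.

(** * Building the lists for the two families of graphs *)

Section Growth.
Variables (T : finType) (e : rel T).
Hypotheses (e_sym : symmetric e) (e_irr : irreflexive e).
Implicit Types (U X Y : {set T}) (S E : seq T).

Lemma strip_start U C S E : strip U C S E -> uniq S /\ S =i U.
Proof. by case=> s [[<- _ _ s0 h] _ _]; apply: h; case: s s0 => //= *; apply: mem_head. Qed.

Lemma connected_pendant r v Y :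
  v \notin Y -> {in Y, forall u, e v u = (u == r)} ->
  connected_on e (v |: Y) = (Y == set0) || (r \in Y) && connected_on e Y.
Proof.
move=> vY vr; have [->|/set0Pn[y yY]] := eqVneq Y set0; first by rewrite setU0 connected1.
apply/idP/andP => [cvY|[rY cY]]; last first.
  by apply: (connected_edgeU e_sym (connected1 e_sym v) cY (set11 v) rY); rewrite vr ?eqxx ?orbT.
have rY : r \in Y.
  have [] := connected_meets_boundary cvY (setU11 _ _) (set11 v) (y := y).
  - by rewrite inE yY orbT.
  - by rewrite inE; apply: contraNneq vY => <-.
  move=> z; rewrite !inE => /orP[-> //|zY] /andP[_ /exists_inP[u]].
  by rewrite inE => /eqP->; rewrite vr // => /eqP <-.
split=> //; apply: (connected_from e_sym rY) => z zY.
have rv : r \in v |: Y by rewrite inE rY orbT.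
have zv : z \in v |: Y by rewrite inE zY orbT.
case/andP: cvY => _ /forall_inP/(_ r rv)/forall_inP/(_ z zv).
(* Being at [v] or being joined to [r] inside [Y] is invariant along a path from [r], because [v]
   can only be left towards [r]. *)
move=> /(connect_exit (B := fun u => (u == v) || connect (induced e Y) r u)).
have -> : z == v = false by apply: contraNF vY => /eqP <-.
apply=> [u w /and3P[uv wv uw]|]; last by rewrite connect0 orbT.
case/setU1P: wv => [->|wY]; first by rewrite eqxx.
case/predU1P => [uv'|ru]; apply/orP; right.
  by move: uw; rewrite uv' vr // => /eqP->; apply: connect0.
case/setU1P: uv => [uv'|uY].
  by move: uw; rewrite uv' vr // => /eqP->; apply: connect0.
by apply: connect_trans ru _; apply: connect1; rewrite /= uY wY.
Qed.

(* The strip and the list of words for U that are needed to attach the next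
   vertex to r; the words of the strip, prefixed by r, are on all of U. *)
Definition grown U r := r \in U /\ exists Q Q' S0,
  [/\ strip (U :\ r) (fun Y => connected_on e (r |: Y)) Q Q', facets e U S0
    & S0 = r :: Q \/ exists x q, Q = x :: q /\ S0 = x :: r :: q].

Lemma grown1 r : grown [set r] r.
Proof.
split; first exact: set11.
exists [::], [::], [:: r]; split; [|apply: facets_discrete|by left] => //.
- have := @strip_perm T [::] isT.
  rewrite (_ : [set x in [::]] = [set r] :\ r); last first.
    by apply/setP => z; rewrite !inE andNb.
  apply: strip_eq => X; rewrite setDv subset0 => /eqP->.
  by rewrite setU0 connected1.
- by move=> z; rewrite !inE.
- by move=> x y; rewrite !inE => /eqP-> /eqP->; rewrite e_irr.
Qed.

Section Pendant.
Variables (U : {set T}) (r v : T).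
Hypotheses (gU : grown U r) (vU : v \notin U).
Hypothesis vr : {in U, forall u, e v u = (u == r)}.

(** For [X] inside [U], [v |: X] is connected exactly when [X] is empty, or contains [r] and is
    connected. Prefixing [r] to the strip of the root [r] therefore gives the strip needed to attach
    [v]. *)
Lemma grown_step : exists Q Q',
  [/\ strip (U :\ r) (fun Y => connected_on e (r |: Y)) Q Q',
      strip U (fun Y => connected_on e (v |: Y)) (r :: Q) (r :: Q')
    & facets e (v |: U) (v :: r :: Q')].
Proof.
have [rU [Q [Q' [S0 [sQ fS lk]]]]] := gU; exists Q, Q'.
have sU : strip U (fun Y => connected_on e (v |: Y)) (r :: Q) (r :: Q').
  have := strip_cons (negbT (setD11 r U)) sQ; rewrite setD1K //.
  apply: strip_eq => X XU; rewrite [RHS](@connected_pendant r).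
  - by case: (boolP (r \in X)) => //= rX; rewrite setD1K.
  - by apply: contra vU; apply: (subsetP XU).
  - by move=> u /(subsetP XU)/vr.
split=> //; apply: (facets_step vU sU fS).
case: lk => [->|[x [q [eQ ->]]]]; [by left | right; exists r, x, q].
have [_ mQ] := strip_start sQ.
have : x \in U :\ r by rewrite -mQ eQ mem_head.
by rewrite !inE eQ => /andP[xr xU]; rewrite !vr ?eqxx.
Qed.

(** Dropping the pendant [v] does not affect connectedness of a set containing [r], so the old strip
    serves twice: backwards with [v] in front and forwards with [v] at the end. *)
Lemma grown_keep : grown (v |: U) r.
Proof.
have [rU _] := gU; have [Q [Q' [sQ _ fU]]] := grown_step.
split; first by rewrite inE rU orbT.
exists (v :: Q'), (rcons Q' v), (v :: r :: Q'); split=> //; last by right; exists v, Q'.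
have rv : r != v by apply: contraNneq vU => <-.
have vUr : v \notin U :\ r by rewrite inE (negPf vU) andbF.
have -> : (v |: U) :\ r = v |: (U :\ r).
  apply/setP => z; rewrite !inE; case: (eqVneq z r) => //= ->.
  by rewrite (negPf rv).
apply: strip_eq (strip_glue vUr (strip_rev sQ) sQ) => X XU.
case: ifP => // vX.
have -> : r |: X = v |: (r |: (X :\ v)) by rewrite setUCA setD1K.
have sub : r |: X :\ v \subset U.
  apply/subsetP => z; rewrite !inE => /orP[/eqP->//|/andP[zv /(subsetP XU)]].
  by rewrite !inE (negPf zv) => /andP[].
rewrite [RHS](@connected_pendant r).
- rewrite setU11 /=; case: eqP => // h.
  by have := setU11 r (X :\ v); rewrite h inE.
- by apply: contra vU => /(subsetP sub).
- by move=> u /(subsetP sub)/vr.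
Qed.

(** The strip used to attach [v] is the one for the root [v]; it is reversed so that its first word,
    prefixed by [v], starts the new list. *)
Lemma grown_move : grown (v |: U) v.
Proof.
have [Q [Q' [_ sU fU]]] := grown_step; split; first exact: setU11.
exists (r :: Q'), (r :: Q), (v :: r :: Q'); split=> //; last by left.
by rewrite setU1K //; apply: strip_rev.
Qed.

End Pendant.

Lemma grown_leaves U r (L : seq T) :
  grown U r -> uniq L -> {in L, forall l, l \notin U /\ e l =1 pred1 r} ->
  grown (U :|: [set x in L]) r.
Proof.
elim: L U => [|l L IH] U gU; first by rewrite (_ : [set x in [::]] = set0) ?setU0 //;
  apply/setP => z; rewrite !inE.
move=> /andP[lL uL] hL; have [lU lr] := hL l (mem_head _ _).
have -> : U :|: [set x in l :: L] = (l |: U) :|: [set x in L].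
  by apply/setP => z; rewrite !inE orbCA orbA.
apply: IH => //; first by apply: grown_keep => // u _; rewrite lr.
move=> k kL; have [kU kr] := hL k (mem_behead (s := l :: L) kL); split=> //.
by rewrite !inE negb_or kU andbT; apply: contraNneq lL => <-.
Qed.

Lemma infix2_index (s : seq T) u x :
  uniq s -> infix [:: u; x] s -> index x s = (index u s).+1.
Proof.
move=> us /infixP[p [q es]]; move: us; rewrite es cat_uniq => /and3P[_ /hasPn h] /=.
rewrite inE negb_or => /andP[/andP[ux _] _].
have [up xp] : u \notin p /\ x \notin p by rewrite !h // !inE eqxx ?orbT.
by rewrite !index_cat (negPf up) (negPf xp) /= !eqxx (negPf ux) addn0 addn1.
Qed.

(** * Caterpillars, built along the spine *)

Section Caterpillar.
Variable s : seq T.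
Hypotheses (us : uniq s) (es : {in s &, forall x y, e x y = consecutive s x y}).
Hypothesis leaves : forall y, y \notin s -> exists2 p, p \in s & e y =1 pred1 p.

(** For [s1] an initial piece of the spine [s], this is [s1] together with the leaves hanging from
    it. *)
Definition part (s1 : seq T) := [set u | (u \in s1) || (u \notin s) && has (e u) s1].

Lemma part_rcons s1 x : x \in s ->
  part (rcons s1 x) =
  (x |: part s1) :|: [set u in enum [set u | (u \notin s) && e u x]].
Proof.
move=> xs; apply/setP => z; rewrite !inE mem_enum inE mem_rcons inE has_rcons.
by case: (z == x); case: (z \in s); case: (z \in s1); case: (e z x); case: has.
Qed.

Lemma grown_part s1 x s2 : s = rcons s1 x ++ s2 ->
  grown (x |: part s1) x -> grown (part (rcons s1 x)) x.
Proof.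
move=> eqs gx; have xs : x \in s by rewrite eqs mem_cat mem_rcons mem_head.
have xs1 : x \notin s1.
  by move: us; rewrite eqs cat_uniq rcons_uniq => /andP[/andP[]].
have s1s u : u \in s1 -> u \in s.
  by move=> h; rewrite eqs mem_cat mem_rcons inE h orbT.
rewrite part_rcons //; apply: grown_leaves => //; first exact: enum_uniq.
move=> l; rewrite mem_enum inE => /andP[ls lx].
have [p ps lp] := leaves ls.
have xp : x = p by apply/eqP; rewrite -[_ == _]/(pred1 p x) -lp.
split; last by rewrite xp.
rewrite !inE ls /= !negb_or; apply/and3P; split.
- by apply: contraNneq ls => ->.
- by apply: contra ls; apply: s1s.
- by apply/hasPn => u us1; rewrite lp /= -xp; apply: contraNneq xs1 => <-.
Qed.

(** The next spine vertex is pendant at the current root and becomes the new root; its leaves are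
    then attached while the root stays. *)
Lemma part_grown s1 x s2 : s = rcons s1 x ++ s2 -> grown (part (rcons s1 x)) x.
Proof.
elim/last_ind: s1 x s2 => [|s1 x' IH] x s2 eqs; apply: (grown_part eqs).
  rewrite (_ : part [::] = set0) ?setU0; first exact: grown1.
  by apply/setP => z; rewrite !inE andbF.
have eqs' : s = rcons s1 x' ++ x :: s2 by rewrite eqs cat_rcons.
have xs : x \in s by rewrite eqs mem_cat mem_rcons mem_head.
have x's : x' \in s by rewrite eqs' mem_cat mem_rcons mem_head.
have xs1 : x \notin rcons s1 x'.
  by move: us; rewrite eqs cat_uniq rcons_uniq => /andP[/andP[]].
apply: (grown_move (IH _ _ eqs')); first by rewrite !inE xs orbF.
(* In the part built so far [x] is adjacent only to [x']: other spine vertices are not consecutive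
   to it, and each leaf has its sole neighbour in the earlier spine. *)
move=> u; rewrite inE => /orP[us1|/andP[uNs /hasP[p ps1 up]]].
  have uins : u \in s by rewrite eqs' mem_cat us1.
  have ix : index x s = size (rcons s1 x').
    by rewrite eqs' index_cat (negPf xs1) /= eqxx addn0.
  have iu : index u s = index u (rcons s1 x') by rewrite eqs' index_cat us1.
  have iu_lt : index u s < index x s by rewrite ix iu index_mem.
  have infx : infix [:: x'; x] s.
    by apply/infixP; exists s1, s2; rewrite eqs' cat_rcons.
  rewrite es //; apply/idP/eqP => [|->]; last by apply/orP; right.
  case/orP => /(infix2_index us) h; first by rewrite h ltnNge leqnSn in iu_lt.
  have := infix2_index us infx; rewrite h => -[] /index_inj; exact.
have [q qs uq] := leaves uNs.
have uNx' : u == x' = false by apply: contraNF uNs => /eqP->.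
rewrite uNx' e_sym uq /=; apply: contraNF xs1 => /eqP ->.
by move: up; rewrite uq => /eqP <-.
Qed.

Lemma spine_facets : s != [::] -> exists S, facets e [set: T] S.
Proof.
case/lastP es': s => [//|s1 x] _.
have [_ [Q [Q' [S0 [_ fS _]]]]] := @part_grown s1 x [::] (etrans es' (esym (cats0 _))).
exists S0; suff <- : part (rcons s1 x) = [set: T] by [].
apply/setP => z; rewrite !inE -es'; case: (boolP (z \in s)) => //= zs.
by have [p ps zp] := leaves zs; apply/hasP; exists p; rewrite ?zp /=.
Qed.

End Caterpillar.

Lemma leafP y : leaf e y -> exists p, e y =1 pred1 p.
Proof.
move=> /cards1P[p ep]; exists p => u; have /setP/(_ u) := ep.
by rewrite !inE.
Qed.

Lemma leaves_component y p : connected_graph e ->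
  e y =1 pred1 p -> e p =1 pred1 y -> forall z, (z == y) || (z == p).
Proof.
case/andP=> _ /forall_inP h yp py z.
have /forall_inP/(_ z (in_setT z)) := h y (in_setT y).
move=> /(connect_exit (B := fun z => (z == y) || (z == p))); rewrite eqxx.
apply=> // u v /and3P[_ _ uv] /orP[/eqP eu|/eqP eu]; move: uv; rewrite eu.
  by rewrite yp /= => ->; rewrite orbT.
by rewrite py /= => ->.
Qed.

Lemma caterpillar_facets : connected_graph e -> caterpillar e ->
  exists S, facets e [set: T] S.
Proof.
move=> hconn [_ [s [us mem_s es]]].
(* A leaf whose neighbour were off the spine would be adjacent to another leaf. The two would then
   be the whole graph, leaving no vertex for the nonempty spine. *)
have leaf_p s' : s' != [::] -> (forall y, y \notin s' -> leaf e y) ->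
    forall y, y \notin s' -> exists2 p, p \in s' & e y =1 pred1 p.
  move=> s'0 hl y ys; have [p yp] := leafP (hl y ys); exists p => //.
  apply: contraT => ps; have [q pq] := leafP (hl p ps).
  have eq_qy : y = q by apply/eqP; rewrite -[_ == _]/(pred1 q y) -pq e_sym yp /=.
  case: s' s'0 ys ps {hl} => // x s' _ ys ps.
  have := leaves_component hconn yp _ x; rewrite eq_qy => /(_ pq)/orP[] /eqP ex.
    by rewrite eq_qy ex mem_head in ys.
  by rewrite ex mem_head in ps.
case: (eqVneq s [::]) => s0; last first.
  apply: (spine_facets us) => //.
    by move=> x y xs ys; apply: es; rewrite -mem_s.
  by apply: leaf_p => // y; rewrite mem_s inE negbK.
(* An empty spine means that every vertex is a leaf; any vertex then serves as a one-vertex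
   spine. *)
have /andP[/set0Pn[x _] _] := hconn.
apply: (@spine_facets [:: x]) => //.
  move=> y z; rewrite !inE => /eqP-> /eqP->; rewrite e_irr /= /consecutive /=.
  by rewrite eqxx.
apply: leaf_p => // y _; apply: contraT => yl.
have : y \in s by rewrite mem_s inE.
by rewrite s0.
Qed.

(** The side [A] alone has no edges; the other vertices are added one at a time. For a new [v], the
    set [v |: X] is connected exactly when [X] is empty or meets [A], which is the strip of
    [strip_bip]. The invariant is that the first word has the shape required there, up to exchanging
    its first two letters. *)
Lemma bipartite_facets (A : {set T}) : A != set0 ->
  (forall x y, e x y = (x \in A) (+) (y \in A)) -> exists S, facets e [set: T] S.
Proof.
move=> A0 eA.
have key bs : uniq bs -> {in bs, forall b, b \notin A} ->
  exists a bs' cs S0, [/\ perm_eq bs' bs, perm_eq (a :: cs) (enum A),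
    facets e (A :|: [set x in bs]) S0
    & S0 = a :: bs' ++ cs \/ exists x q,
        [/\ bs' ++ cs = x :: q, S0 = x :: a :: q & x \notin A]].
  elim: bs => [_ _|v bs IH uvbs hbs].
    have A0' : enum A != [::] by rewrite -size_eq0 -cardE cards_eq0.
    case eA' : (enum A) A0' => [//|a cs] _; exists a, [::], cs, (a :: cs).
    split=> //; last by left.
    rewrite -eA'; apply: facets_discrete; first exact: enum_uniq.
      by move=> z; rewrite mem_enum !inE orbF.
    by move=> x y; rewrite !inE !orbF eA => -> ->.
  have [vbs ubs] : v \notin bs /\ uniq bs by apply/andP.
  have [b bbs|a [bs' [cs [S0 [pb pc fS lk]]]]] := IH ubs.
    by apply: hbs; rewrite inE bbs orbT.
  have vA : v \notin A by apply: hbs; rewrite mem_head.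
  have mcs z : (z \in a :: cs) = (z \in A) by rewrite (perm_mem pc) mem_enum.
  have pw : perm_eq (a :: bs' ++ cs) (bs ++ enum A).
    rewrite -(cat1s a) perm_catCA; exact: perm_cat.
  have uw : uniq (a :: bs' ++ cs).
    rewrite (perm_uniq pw) cat_uniq ubs enum_uniq andbT /=; apply/hasPn => z.
    rewrite mem_enum; apply: contraTN => zbs; apply: hbs; by rewrite inE zbs orbT.
  have eU : [set x in a :: bs' ++ cs] = A :|: [set x in bs].
    by apply/setP => z; rewrite !inE -in_cons (perm_mem pw) mem_cat mem_enum orbC.
  have [a2 [bs2 [cs2 [pb2 pc2 st]]]] := strip_bip uw.
  have vU : v \notin A :|: [set x in bs] by rewrite !inE negb_or vA.
  rewrite eU in st; have {}st : strip (A :|: [set x in bs])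
      (fun X => connected_on e (v |: X)) (a :: bs' ++ cs) (a2 :: bs2 ++ cs2).
    apply: strip_eq st => X XU.
    have vX : v \notin X by apply: contra vU => /(subsetP XU).
    have [->|/set0Pn[y yX]] := eqVneq X set0; first by rewrite setU0 connected1.
    apply/exists_inP/idP => [[x xX]|cX]; rewrite ?mcs.
      move=> xA; have vx : e v x by rewrite eA xA (negPf vA).
      have cvx u : u \in X -> u \in A -> connect (induced e (v |: X)) v u.
        by move=> uX uA; apply: connect1; rewrite /= !inE eqxx uX orbT eA uA (negPf vA).
      apply: (@connected_from _ _ e_sym _ v) => [|z]; first exact: setU11.
      case/setU1P => [->|zX]; first exact: connect0.
      case: (boolP (z \in A)) => zA; first exact: cvx.
      apply: connect_trans (cvx x xX xA) _; apply: connect1.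
      by rewrite /= !inE xX zX !orbT eA xA (negPf zA).
    have [] := connected_meets_boundary cX (setU11 _ _) (set11 v) (y := y).
    - by rewrite inE yX orbT.
    - by rewrite inE; apply: contraNneq vX => <-.
    move=> z zX /boundaryP[zv [u]]; rewrite inE => /eqP->; rewrite eA (negPf vA) => zA.
    exists z; last by rewrite mcs.
    by case/setU1P: zX zA => // ->; rewrite (negPf vA).
  have aA : a \in A by rewrite -mcs mem_head.
  have lk' : link e v (a :: bs' ++ cs) S0.
    case: lk => [->|[x [q [-> -> xA]]]]; [by left | right; exists a, x, q].
    by rewrite !eA aA (negPf vA) (negPf xA).
  have := facets_step vU st fS lk'.
  have -> : v |: (A :|: [set x in bs]) = A :|: [set x in v :: bs].
    by apply/setP => z; rewrite !inE orbCA.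
  (* The new first word starts with [v] and [a2]; exchanging them gives [a2], then [v] with the old
     second side, then the rest of [A]. *)
  move=> fS2; exists a2, (v :: bs2), cs2, (v :: a2 :: bs2 ++ cs2); split=> //.
  - by rewrite perm_cons (perm_trans pb2 pb).
  - exact: perm_trans pc2 pc.
  - by right; exists v, (bs2 ++ cs2).
have [||a [bs' [cs [S0 [_ _ fS _]]]]] := key (enum (~: A)).
- exact: enum_uniq.
- by move=> b; rewrite mem_enum inE.
exists S0; suff <- : A :|: [set x in enum (~: A)] = [set: T] by [].
by apply/setP => z; rewrite !inE mem_enum inE orbN.
Qed.

End Growth.

Unset Implicit Arguments.
Set Strict Implicit.
Set Printing Implicit Defensive.

Theorem theorem1p6 (V : finType) (e : rel V) (n m : nat)
    (he : simple_graph e) (hconn : connected_graph e)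
    (hG : complete_bipartite e n m \/ caterpillar e) :
  exists P : seq (graph_associahedron e), facet_hamiltonian_path P.
Proof.
have [e_sym e_irr] := he.
suff [S fS] : exists S, facets e [set: V] S by apply: facets_path fS.
case: hG => [[A [_ _ eA]]|]; last exact: caterpillar_facets.
(* The construction needs a first letter in the chosen side. If [A] is empty its complement is
   taken, which leaves the edge rule unchanged. *)
have [A0|A0] := eqVneq A set0; last exact: bipartite_facets A0 eA.
have /andP[/set0Pn[x _] _] := hconn.
apply: (@bipartite_facets _ e e_sym (~: A)).
  by apply/set0Pn; exists x; rewrite A0 !inE.
by move=> y z; rewrite eA !inE addbN addNb negbK.
Qed.
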